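(* Let $P_{m,3}$ be a $3$-uniform linear hyperpath with $m\ge 5$ hyperedges. Let $m=3a+b+2$, where $a\ge 1$ and $0\le b\le 2$ are integers. Then $\lambda(P_{m,3})=2a+b+2$.
   Context: A hypergraph $H$ is a pair $(V(H),E(H))$ with $V(H)$ a finite set and $E(H)$ a finite family of non-empty subsets of $V(H)$ (hyperedges) whose union is $V(H)$. Standing assumption: all hypergraphs are connected and Sperner (no hyperedge is a subset of another hyperedge). $H$ is $3$-uniform if every hyperedge has exactly $3$ elements, and linear if $|E_i\cap E_j|\le 1$ for distinct hyperedges $E_i,E_j$. $H$ is a hyperpath if its hyperedges can be ordered as a sequence $E_1,\ldots,E_m$ such that, for $i\neq j$, $E_i\cap E_j\ne\emptyset$ if and only if $|i-j|=1$. For a vertex $u$, $N(u)$ is the set of vertices $v\ne u$ such that some hyperedge contains both $u$ and $v$. A set $S\subseteq V(H)$ is locating-dominating if for any two distinct $u,v\in V(H)-S$, $N(u)\cap S\neq N(v)\cap S$, and $N(u)\cap S\ne\emptyset$ for every $u\in V(H)-S$. $\lambda(H)$ is the minimum cardinality of a locating-dominating set of $H$. *)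

(* Defs.v *)
From mathcomp Require Export all_boot.

Set Implicit Arguments.
Unset Strict Implicit.
Unset Printing Implicit Defensive.

Record hypergraph := Hypergraph {
  vertex :> finType;
  hyperedges : {set {set vertex}};
  hyperedges_nonempty : set0 \notin hyperedges;
  hyperedges_cover : cover hyperedges = [set: vertex]
}.

Section Hypergraphs.

Variable H : hypergraph.

Definition cohyperedge (u v : H) : bool :=
  [exists E in hyperedges H, (u \in E) && (v \in E)].

Definition hconnected : Prop := forall u v : H, connect cohyperedge u v.

(* Repeated hyperedges violate the Sperner condition, so for Sperner
   hypergraphs nothing is lost by storing the family of hyperedges as a set. *)
Definition sperner : Prop :=
  forall E F, E \in hyperedges H -> F \in hyperedges H -> E != F ->
  ~~ (E \subset F).

Definition uniform (k : nat) : Prop :=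
  forall E, E \in hyperedges H -> #|E| = k.

Definition hlinear : Prop :=
  forall E F, E \in hyperedges H -> F \in hyperedges H -> E != F ->
  #|E :&: F| <= 1.

Definition hyperpath : Prop :=
  exists2 s : seq {set H}, perm_eq s (enum (hyperedges H)) &
    forall i j : nat, i < size s -> j < size s -> i != j ->
      (nth set0 s i :&: nth set0 s j != set0) = (i.+1 == j) || (j.+1 == i).

Definition neighbors (u : H) : {set H} :=
  [set v | (v != u) && cohyperedge u v].

Definition locating_dominating (S : {set H}) : bool :=
  [forall u in ~: S, forall v in ~: S,
     (u != v) ==> (neighbors u :&: S != neighbors v :&: S)]
  && [forall u in ~: S, neighbors u :&: S != set0].

(* The full vertex set is vacuously locating-dominating, hence a legitimate
   default for the argmin. *)
Definition lambda : nat :=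
  #|[arg min_(S < [set: H] | locating_dominating S) #|S|]|.

Lemma locating_dominatingT : locating_dominating [set: H].
Proof.
by apply/andP; split; apply/forallP => u; rewrite setCT in_set0.
Qed.

Lemma lambdaP :
  (exists2 S : {set H}, locating_dominating S & #|S| = lambda) /\
  (forall S : {set H}, locating_dominating S -> lambda <= #|S|).
Proof.
rewrite /lambda; case: arg_minnP => [|S ldS minS].
  exact: locating_dominatingT.
by split; first exists S.
Qed.

End Hypergraphs.

(* Main.v *)
Require Import Defs.
From mathcomp Require Import all_boot.
From mathcomp Require Import zify.

Set Implicit Arguments.
Unset Strict Implicit.
Unset Printing Implicit Defensive.

(** A 3-uniform linear hyperpath with [m] hyperedges looks the same whichever
    one it is: its vertices can be numbered [0, ..., 2 * m] so that the [i]-th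
    hyperedge consists of [2 * i], [2 * i + 1] and [2 * i + 2]
    ([hyperpath_numbering]).  For [0 < i < m] the number [2 * i] is the vertex
    shared by two consecutive hyperedges; odd numbers, together with [0] and
    [2 * m], lie in one hyperedge only.  Through this numbering,
    locating-dominating sets become boolean functions on numbers that dominate
    and separate in an arithmetical sense ([locating_dominating_numbered]).

    Lower bound.  The two vertices private to the first hyperedge are twins,
    hence cannot both be left out; the same holds for the last hyperedge.
    In between there are [m - 2 = 3 * a + b] hyperedges.  Every one of them
    contains a chosen vertex, because its private vertex is chosen or dominated.
    If the private vertices [k + 1] and [k + 3] of two consecutive hyperedges are
    both left out, then [k] or [k + 4] is chosen, as otherwise they would see the
    shared vertex [k + 2] only.  Hence two consecutive hyperedges always cost two
    vertices ([hyperedge_pair_lower_bound]).  Grouping the inner hyperedges by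
    three, and leaving the third of each group uncounted so that no vertex is
    counted twice, yields [2 * a]; the [b] remaining hyperedges cost [b] more
    ([tail_lower_bound]).

    Upper bound.  Choosing [0], [2 * m], and among the shared vertices two out
    of every three in the periodic order out, in, in, out, in, in, ... gives a
    locating-dominating set of the required size ([pattern_dominates],
    [pattern_separates], [pattern_weight]). *)

(** * Numbering the vertices of a hyperpath *)

Lemma choose_from_sets (T : finType) (A : nat -> {set T}) (n : nat) :
  0 < n -> (forall i, i < n -> A i != set0) ->
  exists g : nat -> T, forall i, i < n -> g i \in A i.
Proof.
move=> n_gt0 A_neq0; have [x0 _] := set0Pn _ (A_neq0 0 n_gt0).
exists (fun i => odflt x0 [pick x in A i]) => i lt_in.
case: pickP => [//|A0]; have [x] := set0Pn _ (A_neq0 i lt_in).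
by rewrite A0.
Qed.

(** For [0 < i < m] this is the intersection of two consecutive hyperedges, a
    single vertex; at [0] and [m] it consists of the two vertices private to
    the first or last hyperedge, either of which may serve as an end of the
    path. *)
Definition joint (T : finType) (E : nat -> {set T}) (m i : nat) : {set T} :=
  if i == 0 then E 0 :\: E 1
  else if i == m then E m.-1 :\: E m.-2
  else E i.-1 :&: E i.

(** The vertices at even positions.  Two hyperedges that share a vertex are at
    most one apart, so a vertex of hyperedges [i - 1] and [i] lies in no
    other. *)
Lemma path_joints (T : finType) (E : nat -> {set T}) (m : nat) :
  1 < m -> (forall i, i < m -> #|E i| = 3) ->
  (forall i j, i < m -> j < m -> i != j -> #|E i :&: E j| <= 1) ->
  (forall i j, i < m -> j < m -> i != j ->
     (E i :&: E j != set0) = (i.+1 == j) || (j.+1 == i)) ->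
  exists c : nat -> T,
    (forall i j, i <= m -> j < m -> (c i \in E j) = (j <= i <= j.+1)) /\
    (forall i, i < m -> c i != c i.+1).
Proof.
move=> m_gt1 cardE linE meetE.
have joint_neq0 i : i < m.+1 -> joint E m i != set0.
  move=> le_im; rewrite /joint.
  case: (eqVneq i 0) => [_|i_neq0].
    have := cardsID (E 1) (E 0); have := linE 0 1 ltac:(lia) m_gt1 isT.
    by rewrite -card_gt0 cardE; lia.
  case: (eqVneq i m) => [_|i_neqm].
    have := cardsID (E m.-2) (E m.-1).
    have := linE m.-1 m.-2 ltac:(lia) ltac:(lia) ltac:(lia).
    by rewrite -card_gt0 cardE; lia.
  by rewrite meetE; lia.
have [c cP] := choose_from_sets (ltn0Sn m) joint_neq0.
have far i j v : i < m -> j < m -> v \in E i -> v \in E j ->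
    (i <= j.+1) && (j <= i.+1).
  move=> lt_im lt_jm vEi vEj; have [->|neq_ij] := eqVneq i j; first by lia.
  have : E i :&: E j != set0 by apply/set0Pn; exists v; rewrite inE vEi.
  by rewrite meetE //; lia.
have c_mem i j : i <= m -> j < m -> (c i \in E j) = (j <= i <= j.+1).
  move=> le_im lt_jm; have := cP i le_im; rewrite /joint.
  case: (eqVneq i 0) => [->|i_neq0].
    rewrite inE => /andP[cE1 cE0].
    have [->|j_neq0] := eqVneq j 0; first by rewrite cE0.
    have [->|j_neq1] := eqVneq j 1; first by rewrite (negbTE cE1).
    apply/idP/idP => [cEj|]; last by lia.
    by have := far _ _ _ (ltnW m_gt1) lt_jm cE0 cEj; lia.
  case: (eqVneq i m) => [->|i_neqm].
    rewrite inE => /andP[cE1 cE0].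
    have [->|j_neq0] := eqVneq j m.-1; first by rewrite cE0; lia.
    have [->|j_neq1] := eqVneq j m.-2; first by rewrite (negbTE cE1); lia.
    apply/idP/idP => [cEj|]; last by lia.
    by have := far m.-1 _ _ ltac:(lia) lt_jm cE0 cEj; lia.
  rewrite inE => /andP[cE1 cE0]; apply/idP/idP => [cEj|].
    have := far i j _ ltac:(lia) lt_jm cE0 cEj.
    by have := far i.-1 j _ ltac:(lia) lt_jm cE1 cEj; lia.
  move=> j_bounds; have [->//|j_neqi] := eqVneq j i.
  by have -> : j = i.-1 by lia.
exists c; split=> // i lt_im; apply/eqP => eq_c.
have [i1|i_neq1] := ltnP i.+1 m.
  have := c_mem i i.+1 ltac:(lia) i1.
  by rewrite eq_c c_mem; lia.
have := c_mem i.+1 i.-1 ltac:(lia) ltac:(lia).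
by rewrite -eq_c c_mem; lia.
Qed.

(** Odd positions are filled with the vertex of a hyperedge that is left over
    by its two joints.  It cannot lie in a second hyperedge: that one would be
    a neighbour on the path, hence share a joint as well, against linearity. *)
Lemma path_numbering (T : finType) (E : nat -> {set T}) (m : nat) :
  1 < m -> (forall i, i < m -> #|E i| = 3) ->
  (forall i j, i < m -> j < m -> i != j -> #|E i :&: E j| <= 1) ->
  (forall i j, i < m -> j < m -> i != j ->
     (E i :&: E j != set0) = (i.+1 == j) || (j.+1 == i)) ->
  exists f : nat -> T,
    (forall k i, k <= 2 * m -> i < m ->
       (f k \in E i) = (2 * i <= k <= 2 * i + 2)) /\
    (forall i, i < m -> uniq [:: f (2 * i); f (2 * i + 1); f (2 * i + 2)]).
Proof.
move=> m_gt1 cardE linE meetE.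
have [c [c_mem c_neq]] := path_joints m_gt1 cardE linE meetE.
have private_neq0 i : i < m -> E i :\: [set c i; c i.+1] != set0.
  move=> lt_im; have := cardsID [set c i; c i.+1] (E i).
  have := subset_leq_card (subsetIr (E i) [set c i; c i.+1]).
  by rewrite cards2 c_neq // -card_gt0 cardE //=; lia.
have [p pP] := choose_from_sets (ltnW m_gt1) private_neq0.
have pE i : i < m -> p i \in E i by move=> /pP; rewrite inE => /andP[].
have p_neq i : i < m -> (p i != c i) && (p i != c i.+1).
  by move=> /pP; rewrite !inE negb_or => /andP[].
have two_common i j x y : i < m -> j < m -> x \in E i -> y \in E i ->
    x \in E j -> y \in E j -> x != y -> i = j.
  move=> lt_im lt_jm xi yi xj yj neq_xy; apply/eqP/negPn/negP => neq_ij.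
  have := linE i j lt_im lt_jm neq_ij; apply/negP; rewrite -ltnNge.
  rewrite -(_ : #|[set x; y]| = 2); last by rewrite cards2 neq_xy.
  apply: subset_leq_card; apply/subsetP => z /set2P[] ->; by rewrite inE ?xi ?yi.
have p_mem i j : i < m -> j < m -> (p i \in E j) = (j == i).
  move=> lt_im lt_jm; have [->|neq_ji] := eqVneq j i; first exact: pE.
  apply/negP => pEj; have /andP[p_neq_c p_neq_c'] := p_neq i lt_im.
  have : E i :&: E j != set0.
    by apply/set0Pn; exists (p i); rewrite inE pE.
  rewrite meetE // 1?eq_sym // => /orP[/eqP eq_ij|/eqP eq_ij].
    have := two_common i j (p i) (c i.+1) lt_im lt_jm.
    by rewrite !c_mem ?pE ?pEj //; lia.
  have := two_common i j (p i) (c i) lt_im lt_jm.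
  by rewrite !c_mem ?pE ?pEj //; lia.
exists (fun k => if odd k then p k./2 else c k./2); split.
  move=> k i le_k lt_im; case: ifP => odd_k; first by rewrite p_mem; lia.
  by rewrite c_mem; lia.
move=> i lt_im /=.
have -> : odd (2 * i) = false by lia.
have -> : odd (2 * i + 1) by lia.
have -> : odd (2 * i + 2) = false by lia.
have -> : (2 * i)./2 = i by lia.
have -> : (2 * i + 1)./2 = i by lia.
have -> : (2 * i + 2)./2 = i.+1 by lia.
rewrite !inE negb_or andbT eq_sym c_neq // andbT.
by have /andP[] := p_neq i lt_im; rewrite eq_sym => -> ->.
Qed.

(** Numbers [k <= l] lie in a common interval [2 * i, 2 * i + 2] exactly when
    [l] does not exceed the end of the last such interval containing [k]; the
    other conjunct makes the relation symmetric.  The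
    length of the path does not intervene, as long as both numbers are at most
    [2 * m]. *)
Definition same_edge (k l : nat) : bool :=
  (k <= l./2.*2 + 2) && (l <= k./2.*2 + 2).

Lemma hyperpath_numbering (P : hypergraph) (m : nat) :
  uniform P 3 -> hlinear P -> hyperpath P -> #|hyperedges P| = m -> 1 < m ->
  exists f : nat -> P,
    [/\ {in [pred k | k <= 2 * m] &, injective f},
        forall v, exists2 k, k <= 2 * m & v = f k
      & forall k l, k <= 2 * m -> l <= 2 * m ->
          cohyperedge (f k) (f l) = same_edge k l].
Proof.
move=> uniP linP [s perm_s meet_s] card_m m_gt1.
have size_s : size s = m by rewrite (perm_size perm_s) -cardE.
have uniq_s : uniq s by rewrite (perm_uniq perm_s) enum_uniq.
have mem_s F : (F \in s) = (F \in hyperedges P).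
  by rewrite (perm_mem perm_s) mem_enum.
pose E i := nth set0 s i.
have E_hyperedge i : i < m -> E i \in hyperedges P.
  by move=> lt_im; rewrite -mem_s mem_nth ?size_s.
have hyperedge_E F : F \in hyperedges P -> exists2 i, i < m & F = E i.
  rewrite -mem_s => sF; exists (index F s); first by rewrite -size_s index_mem.
  by rewrite /E nth_index.
have cardE i : i < m -> #|E i| = 3 by move=> /E_hyperedge /uniP.
have linE i j : i < m -> j < m -> i != j -> #|E i :&: E j| <= 1.
  move=> lt_im lt_jm neq_ij; apply: linP; rewrite ?E_hyperedge //.
  by rewrite nth_uniq ?size_s.
have meetE i j : i < m -> j < m -> i != j ->
    (E i :&: E j != set0) = (i.+1 == j) || (j.+1 == i).
  by rewrite -size_s; apply: meet_s.
have [f [f_mem f_uniq]] := path_numbering m_gt1 cardE linE meetE.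
have edge_of k l : k <= 2 * m -> l <= 2 * m -> same_edge k l ->
    exists2 i, i < m & (2 * i <= k <= 2 * i + 2) && (2 * i <= l <= 2 * i + 2).
  rewrite /same_edge => le_k le_l kl.
  (* The minimum with [m.-1] matters only for the last vertex, [2 * m]. *)
  by exists (minn (minn k./2 l./2) m.-1); lia.
exists f; split.
- move=> k l; rewrite !inE => le_k le_l eq_f.
  have [i lt_im i_k] : exists2 i, i < m & 2 * i <= k <= 2 * i + 2.
    by exists (minn k./2 m.-1); lia.
  have : f l \in E i by rewrite -eq_f f_mem.
  rewrite f_mem // => i_l; have := f_uniq i lt_im.
  rewrite /= !inE negb_or andbT -andbA => /and3P[n01 n02 n12].
  have cases j : 2 * i <= j <= 2 * i + 2 ->
      [\/ j = 2 * i, j = 2 * i + 1 | j = 2 * i + 2].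
    move=> j_bounds; have [->|j0] := eqVneq j (2 * i); first by constructor.
    have [->|j1] := eqVneq j (2 * i + 1); first by constructor.
    by constructor 3; lia.
  move: eq_f n01 n02 n12.
  by case: (cases k i_k) => ->; case: (cases l i_l) => -> //= ->; rewrite ?eqxx.
- move=> v; have : v \in cover (hyperedges P).
    by rewrite hyperedges_cover inE.
  case/bigcupP=> F /hyperedge_E[i lt_im ->] vE.
  have sub : [set x in [:: f (2 * i); f (2 * i + 1); f (2 * i + 2)]] = E i.
    apply/eqP; rewrite eqEcard cardE // cardsE (card_uniqP (f_uniq i lt_im)).
    rewrite andbT; apply/subsetP => x; rewrite !inE.
    by case/or3P=> /eqP ->; rewrite f_mem; lia.
  move: vE; rewrite -sub !inE => /or3P[] /eqP ->.
  + by exists (2 * i); first lia.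
  + by exists (2 * i + 1); first lia.
  + by exists (2 * i + 2); first lia.
- move=> k l le_k le_l; apply/existsP/idP => [[F]|].
    case/and3P=> /hyperedge_E[i lt_im ->].
    by rewrite !f_mem // /same_edge; lia.
  case/(edge_of _ _ le_k le_l) => i lt_im /andP[i_k i_l].
  by exists (E i); rewrite E_hyperedge // !f_mem // i_k.
Qed.

Lemma card_numbered (T : finType) (f : nat -> T) (n : nat) (S : {set T}) :
  {in [pred k | k < n] &, injective f} ->
  (forall v, exists2 k, k < n & v = f k) ->
  #|S| = \sum_(0 <= k < n) (f k \in S).
Proof.
move=> f_inj f_surj; pose g (k : 'I_n) := f k.
have g_inj : injective g.
  by move=> k l eq_g; apply/val_inj/f_inj => //; rewrite inE ltn_ord.
have {1}-> : S = g @: [set k | g k \in S].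
  apply/setP => v; apply/idP/imsetP => [vS|[k]]; last by rewrite inE => ? ->.
  have [k lt_kn eq_v] := f_surj v.
  by exists (Ordinal lt_kn); rewrite ?inE /g /= -eq_v.
rewrite card_imset // big_mkord cardsE -sum1_card big_mkcond /=.
by apply: eq_bigr => k _; rewrite -[k \in _]/(f k \in S); case: (f k \in S).
Qed.

(** * Locating-dominating sets in terms of the numbering *)

(** Here and in the separation condition, the reflexive relation [same_edge]
    replaces adjacency: a vertex outside the set is never its own chosen
    neighbour. *)
Definition dominates (m : nat) (s : nat -> bool) : Prop :=
  forall k, k <= 2 * m -> ~~ s k ->
    exists2 q, q <= 2 * m & s q && same_edge k q.

Definition separates (m : nat) (s : nat -> bool) : Prop :=
  forall k l, k < l -> l <= 2 * m -> ~~ s k -> ~~ s l ->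
    exists2 q, q <= 2 * m & s q && (same_edge k q != same_edge l q).

Lemma locating_dominating_numbered (P : hypergraph) (f : nat -> P) (m : nat)
    (S : {set P}) :
  {in [pred k | k <= 2 * m] &, injective f} ->
  (forall v, exists2 k, k <= 2 * m & v = f k) ->
  (forall k l, k <= 2 * m -> l <= 2 * m ->
     cohyperedge (f k) (f l) = same_edge k l) ->
  locating_dominating S <->
    dominates m (fun k => f k \in S) /\ separates m (fun k => f k \in S).
Proof.
move=> f_inj f_surj f_adj.
have trace k q : k <= 2 * m -> q <= 2 * m -> f k \notin S ->
    (f q \in neighbors (f k) :&: S) = (f q \in S) && same_edge k q.
  move=> le_k le_q kS; rewrite !inE f_adj // andbC.
  case qS: (f q \in S) => //=; case: eqP => // eq_f.
  by rewrite -eq_f qS in kS.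
rewrite /dominates /separates /=; split=> [/andP[/forallP sep /forallP dom]|[dom sep]].
  split=> [k le_k kS|k l lt_kl le_l kS lS].
    have /set0Pn[v] : neighbors (f k) :&: S != set0.
      by have := dom (f k); rewrite !inE kS.
    have [q le_q ->] := f_surj v.
    by rewrite trace // => ?; exists q.
  have le_k : k <= 2 * m by lia.
  have neq_f : f k != f l.
    by apply/eqP => /f_inj; rewrite !inE; lia.
  have neqN : neighbors (f k) :&: S != neighbors (f l) :&: S.
    have := sep (f k); rewrite !inE kS => /forallP/(_ (f l)).
    by rewrite !inE lS neq_f.
  have [v neq_v] : exists v, (v \in neighbors (f k) :&: S)
                          != (v \in neighbors (f l) :&: S).
    apply/existsP; apply: contraNT neqN => /existsPn same.
    by apply/eqP/setP => v; apply/eqP/negPn.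
  have [q le_q eq_v] := f_surj v; exists q => //.
  by move: neq_v; rewrite eq_v !trace //; case: (f q \in S).
have sepS k l : k < l -> l <= 2 * m -> f k \notin S -> f l \notin S ->
    neighbors (f k) :&: S != neighbors (f l) :&: S.
  move=> lt_kl le_l kS lS; have [q le_q /andP[qS neq_q]] :=
    sep k l lt_kl le_l kS lS.
  have le_k : k <= 2 * m by lia.
  by apply: contraNneq neq_q => /setP/(_ (f q)); rewrite !trace // qS /= => ->.
apply/andP; split.
  apply/forall_inP => u; rewrite inE => uS.
  apply/forall_inP => v; rewrite inE => vS; apply/implyP => neq_uv.
  have [k le_k eq_u] := f_surj u; have [l le_l eq_v] := f_surj v; subst u v.
  case: (ltngtP k l) => [lt_kl|lt_lk|eq_kl]; first exact: sepS.
    by rewrite eq_sym; apply: sepS.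
  by rewrite eq_kl eqxx in neq_uv.
apply/forall_inP => u; rewrite inE => uS; have [k le_k eq_u] := f_surj u.
subst u; have [q le_q kq] := dom k le_k uS.
by apply/set0Pn; exists (f q); rewrite trace.
Qed.

(** * Lower bound *)

Lemma sum_blocks (F : nat -> nat) (d c n : nat) :
  \sum_(c <= k < c + d * n) F k =
  \sum_(0 <= t < n) \sum_(0 <= j < d) F (c + d * t + j).
Proof.
elim: n => [|n IHn]; first by rewrite muln0 addn0 !big_geq.
rewrite big_nat_recr //= -IHn (@big_cat_nat _ _ _ (c + d * n)) /=; try lia.
congr (_ + _); rewrite -{1}[c + d * n]add0n big_addn.
have -> : c + d * n.+1 - (c + d * n) = d by lia.
by apply: eq_bigr => j _; rewrite addnC.
Qed.

(** The numbers [0] and [1] have the same neighbours apart from themselves, and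
    so do the last two numbers. *)
Lemma separates_twins (m : nat) (s : nat -> bool) (k : nat) :
  separates m s -> k < 2 * m -> (k == 0) || (k.+1 == 2 * m) ->
  s k || s k.+1.
Proof.
move=> sep lt_k k_end; apply/negPn/negP; rewrite negb_or => /andP[sk sk1].
have [q le_q /andP[sq]] := sep k k.+1 (ltnSn k) lt_k sk sk1.
have q_neq j : ~~ s j -> q != j by apply: contraNneq => <-.
have := q_neq _ sk; have := q_neq _ sk1; rewrite /same_edge; lia.
Qed.

(** Apply domination to the private vertex [k.+1] of the hyperedge that starts
    at [k]. *)
Lemma dominates_edge (m : nat) (s : nat -> bool) (k : nat) :
  dominates m s -> ~~ odd k -> k < 2 * m -> [|| s k, s k.+1 | s k.+2].
Proof.
move=> dom even_k lt_k; apply/negPn/negP; rewrite !negb_or => /and3P[s0 s1 s2].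
have [q le_q /andP[sq]] := dom k.+1 lt_k s1.
have q_neq j : ~~ s j -> q != j by apply: contraNneq => <-.
have := q_neq _ s0; have := q_neq _ s1; have := q_neq _ s2.
rewrite /same_edge; lia.
Qed.

(** If all four were missing, the private vertices [k.+1] and [k.+3] of two
    consecutive hyperedges could see nothing but their common neighbour
    [k.+2]. *)
Lemma separates_private (m : nat) (s : nat -> bool) (k : nat) :
  separates m s -> ~~ odd k -> k.+3 <= 2 * m ->
  [|| s k, s k.+1, s k.+3 | s k.+4].
Proof.
move=> sep even_k le_k; apply/negPn/negP.
rewrite !negb_or => /and4P[s0 s1 s3 s4].
have [q le_q /andP[sq]] := sep k.+1 k.+3 (leqW (ltnSn _)) le_k s1 s3.
have q_neq j : ~~ s j -> q != j by apply: contraNneq => <-.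
have := q_neq _ s0; have := q_neq _ s1; have := q_neq _ s3.
have := q_neq _ s4; rewrite /same_edge; lia.
Qed.

(** Two consecutive hyperedges sharing [k.+2] cost two vertices.  A single chosen
    vertex meeting both would be [k.+2], which leaves the two private
    vertices inseparable. *)
Lemma hyperedge_pair_lower_bound (m : nat) (s : nat -> bool) (k : nat) :
  dominates m s -> separates m s -> ~~ odd k -> k.+3 <= 2 * m ->
  2 <= \sum_(0 <= j < 5) s (k + j).
Proof.
move=> dom sep even_k lt_k.
have := dominates_edge dom even_k ltac:(lia).
have := @dominates_edge m s k.+2 dom ltac:(lia) ltac:(lia).
have := separates_private sep even_k lt_k.
rewrite !big_nat_recr //= big_geq // !addnS !addn0.
by case: (s k); case: (s k.+1); case: (s k.+2); case: (s k.+3);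
   case: (s k.+4).
Qed.

(** The last [b] inner hyperedges together with the two private vertices of the
    final hyperedge. *)
Lemma tail_lower_bound (m : nat) (s : nat -> bool) (b k : nat) :
  dominates m s -> separates m s -> b <= 2 -> 2 * m = k + 2 * b + 2 ->
  b + 1 <= \sum_(0 <= j < 2 * b + 3) s (k + j).
Proof.
move=> dom sep b_le2 m_eq; have even_k : ~~ odd k by lia.
have twins := @separates_twins m s (2 * m).-1 sep ltac:(lia) ltac:(lia).
case: b b_le2 m_eq => [|[|[|//]]] _ m_eq.
- rewrite !big_nat_recr //= big_geq // !addnS !addn0.
  have e : (2 * m).-1 = k.+1 by lia.
  by move: twins; rewrite e; case: (s k); case: (s k.+1); case: (s k.+2).
- rewrite !big_nat_recr //= big_geq // !addnS !addn0.
  have e : (2 * m).-1 = k.+3 by lia.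
  have := dominates_edge dom even_k ltac:(lia).
  move: twins; rewrite e.
  by case: (s k); case: (s k.+1); case: (s k.+2); case: (s k.+3);
     case: (s k.+4).
- rewrite big_nat_recr //= big_nat_recr //= -addnA.
  have e : (2 * m).-1 = k + 5 by lia.
  have := hyperedge_pair_lower_bound dom sep even_k ltac:(lia).
  by move: twins; rewrite e -addnS; lia.
Qed.

Lemma lower_bound (m a b : nat) (s : nat -> bool) :
  m = 3 * a + b + 2 -> b <= 2 -> dominates m s -> separates m s ->
  2 * a + b + 2 <= \sum_(0 <= k < (2 * m).+1) s k.
Proof.
move=> m_eq b_le2 dom sep.
rewrite (@big_cat_nat _ _ _ (2 + 6 * a)) /=; try lia.
rewrite (@big_cat_nat _ _ _ 2) /=; try lia.
have start : 1 <= \sum_(0 <= k < 2) s k.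
  have := separates_twins sep (ltac:(lia) : 0 < 2 * m) isT.
  by rewrite !big_nat_recr //= big_geq //; lia.
have blocks : 2 * a <= \sum_(2 <= k < 2 + 6 * a) s k.
  rewrite sum_blocks mulnC -[a in a * 2]subn0 -sum_nat_const_nat.
  rewrite big_nat [leqRHS]big_nat; apply: leq_sum => t lt_ta.
  (* Position [5] is the private vertex of the third hyperedge. *)
  rewrite big_nat_recr //=; apply: leq_trans (leq_addr _ _).
  by apply: (hyperedge_pair_lower_bound dom sep); lia.
have finish : b + 1 <= \sum_(2 + 6 * a <= k < (2 * m).+1) s k.
  rewrite -[2 + 6 * a]add0n big_addn.
  have -> : (2 * m).+1 - (2 + 6 * a) = 2 * b + 3 by lia.
  under eq_bigr do rewrite addnC.
  by apply: (tail_lower_bound dom sep) => //; lia.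
by lia.
Qed.

(** * Upper bound *)

(** The even numbers, except the shared vertices congruent to [2] modulo [6].
    The last vertex [2 * m] has that residue when [b = 2] and has to be added by
    hand. *)
Definition pattern (m k : nat) : bool :=
  ~~ odd k && ((k %% 6 != 2) || (k == 2 * m)).

Lemma pattern_dominates (m : nat) : 1 < m -> dominates m (pattern m).
Proof.
move=> m_gt1 k le_k; rewrite /pattern => sk.
rewrite /same_edge.
have [k2|k_neq2] := eqVneq (k %% 6) 2; first by exists k.+2; lia.
have [k3|k_neq3] := eqVneq (k %% 6) 3; first by exists k.+1; lia.
by exists k.-1; lia.
Qed.

(** For [k < l], the least chosen neighbour of [k] is normally too far from
    [l].  The exceptions are [k = 6 * t + 1] with [l = k + 1] and
    [k = 6 * t + 3] with [l = k + 2], where the trace of [k] is contained in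
    that of [l]; there [k + 3] is a neighbour of [l] only. *)
Lemma pattern_separates (m : nat) : separates m (pattern m).
Proof.
move=> k l lt_kl le_l; rewrite /pattern => sk sl.
rewrite /same_edge.
case nested: ((l == k.+1) && (k %% 6 == 1) || (l == k.+2) && (k %% 6 == 3)).
  by exists k.+3; lia.
have [k2|k_neq2] := eqVneq (k %% 6) 2; first by exists k.-2; lia.
have [k3|k_neq3] := eqVneq (k %% 6) 3; first by exists k.+1; lia.
by exists k.-1; lia.
Qed.

Lemma pattern_period (m t j : nat) :
  6 * t + j < 2 * m -> pattern m (6 * t + j) = ~~ odd j && (j %% 6 != 2).
Proof.
move=> lt_k; rewrite /pattern (ltn_eqF lt_k) orbF oddD oddM /=.
by rewrite mulnC modnMDl.
Qed.

Lemma pattern_weight (m a b : nat) :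
  m = 3 * a + b + 2 -> b <= 2 ->
  \sum_(0 <= k < (2 * m).+1) pattern m k = 2 * a + b + 2.
Proof.
move=> m_eq b_le2; rewrite big_nat_recr //=.
have -> : pattern m (2 * m) by rewrite /pattern eqxx orbT oddM.
have -> : 2 * m = 6 * a + (2 * b + 4) by lia.
rewrite (@big_cat_nat _ _ _ (0 + 6 * a)) ?leq_addr //= sum_blocks.
have -> : \sum_(0 <= t < a) \sum_(0 <= j < 6) pattern m (0 + 6 * t + j) = 2 * a.
  rewrite mulnC -[a in a * 2]subn0 -sum_nat_const_nat.
  apply: eq_big_nat => t /andP[_ lt_ta].
  transitivity (\sum_(0 <= j < 6) (~~ odd j && (j %% 6 != 2))).
    apply: eq_big_nat => j /andP[_ lt_j6].
    by rewrite add0n pattern_period //; lia.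
  by rewrite !big_nat_recr //= big_geq.
have -> : \sum_(0 + 6 * a <= k < 6 * a + (2 * b + 4)) pattern m k = b + 1.
  rewrite -[0 + 6 * a]add0n big_addn add0n addKn.
  transitivity (\sum_(0 <= j < 2 * b + 4) (~~ odd j && (j %% 6 != 2))).
    apply: eq_big_nat => j /andP[_ lt_j].
    by rewrite addnC pattern_period //; lia.
  by case: b b_le2 {m_eq} => [|[|[|//]]] _; rewrite !big_nat_recr //= big_geq.
by rewrite -!addnA.
Qed.

(** * The location-domination number *)

Theorem theorem3p7 (P : hypergraph) (m a b : nat)
  (P_connected : hconnected P) (P_sperner : sperner P)
  (P_uniform : uniform P 3) (P_linear : hlinear P) (P_hyperpath : hyperpath P)
  (P_size : #|hyperedges P| = m) (m_ge5 : 5 <= m)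
  (m_eq : m = 3 * a + b + 2) (a_ge1 : 1 <= a) (b_le2 : 0 <= b <= 2) :
  lambda P = 2 * a + b + 2.
Proof.
have [f [f_inj f_surj f_adj]] :=
  hyperpath_numbering P_uniform P_linear P_hyperpath P_size ltac:(lia).
have ldE S := @locating_dominating_numbered P f m S f_inj f_surj f_adj.
have cardE S := @card_numbered P f (2 * m).+1 S f_inj f_surj.
have [[S ldS <-] lambda_le] := lambdaP P; apply/eqP; rewrite eqn_leq.
apply/andP; split; last first.
  have /ldE[dom sep] := ldS; rewrite cardE.
  exact: lower_bound m_eq _ dom sep.
pose S0 := [set v | [exists k : 'I_(2 * m).+1, (v == f k) && pattern m k]].
have S0E k : k <= 2 * m -> (f k \in S0) = pattern m k.
  move=> le_k; rewrite inE; apply/existsP/idP => [[l /andP[/eqP eq_f]]|pk].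
    by rewrite (f_inj k l) // inE -ltnS ltn_ord.
  by exists (Ordinal (le_k : k < (2 * m).+1)); rewrite eqxx.
have ldS0 : locating_dominating S0.
  apply/ldE; split=> [k le_k|k l lt_kl le_l].
    rewrite S0E // => /(@pattern_dominates m ltac:(lia) k le_k)[q le_q q_ok].
    by exists q; rewrite ?S0E.
  rewrite !S0E; try lia.
  move=> sk sl; have [q le_q q_ok] := pattern_separates lt_kl le_l sk sl.
  by exists q; rewrite ?S0E.
rewrite (leq_trans (lambda_le _ ldS0)) // cardE.
rewrite (_ : \sum_(0 <= k < _) _ = \sum_(0 <= k < (2 * m).+1) pattern m k).
  by rewrite (pattern_weight m_eq).
by apply: eq_big_nat => k /andP[_ lt_k]; rewrite S0E.
Qed.
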